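(* For all points $O,A,B,C$: (reflexivity) if $O\neq A$ then $A$ and $A$ lie on the same half-line from $O$; (symmetry) if $A,B$ lie on the same half-line from $O$, then $B,A$ lie on the same half-line from $O$; (transitivity) if $A,B$ lie on the same half-line from $O$ and $B,C$ lie on the same half-line from $O$, then $A,C$ lie on the same half-line from $O$.
   Context: Synthetic plane geometry with classical logic. Primitive notions: points, lines (with equality), incidence $A\in x$, a ternary betweenness relation $\mathrm{Bet}(A,B,C)$ on points (''$B$ strictly between $A$ and $C$''), lengths with a map $(A,B)\mapsto|AB|$. Points are collinear if some line contains all of them. Axioms: (incidence) there is a point; for every point there is a distinct point; every line has a point; for every line $x$ and $A\in x$ there is $B\in x$, $B\neq A$; for every line there is a point not on it; through two distinct points there is a line; if $A\neq B$, $A,B\in x$ and $x\neq y$ then $A\notin y$ or $B\notin y$. (betweenness) if $\mathrm{Bet}(A,B,C)$ then $A\neq C$, $A,B,C$ are collinear, $\mathrm{Bet}(C,B,A)$, and not $\mathrm{Bet}(B,A,C)$. (lengths) $|AB|=|CC|$ iff $A=B$; $|AB|=|BA|$. (line–circle) for $O,A,B$ with $A\neq O$ there is $C$ with ($\mathrm{Bet}(A,O,C)$ or $O=C$) and $|OB|=|OC|$. ''$A,B$ lie on opposite sides of line $x$'': $A,B\notin x$ and some $O\in x$ has $\mathrm{Bet}(A,O,B)$; ''same side'': $A,B\notin x$ and no such $O$. (Pasch) if $A,B$ lie on opposite sides of $x$ and $C\notin x$, then $A,C$ or $C,B$ lie on opposite sides of $x$. Definition: ''$A$ and $B$ lie on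 the same half-line from $O$'' means $O\neq A$, $O\neq B$, $O,A,B$ are collinear, and not $\mathrm{Bet}(A,O,B)$. *)

(* Defs.v *)
Set Implicit Arguments.
Unset Strict Implicit.
Unset Printing Implicit Defensive.

Record geometry := Geometry {
  Point : Type;
  Line : Type;
  Length : Type;
  incident : Point -> Line -> Prop;
  (* [Bet A B C]: [B] is strictly between [A] and [C]. *)
  Bet : Point -> Point -> Point -> Prop;
  dist : Point -> Point -> Length
}.

Section Notions.
Variable G : geometry.
Implicit Types (A B C O : Point G) (x : Line G).

Definition collinear A B C : Prop :=
  exists x, incident A x /\ incident B x /\ incident C x.

Definition opposite_sides A B x : Prop :=
  ~ incident A x /\ ~ incident B x /\ exists O, incident O x /\ Bet A O B.

Definition same_half_line O A B : Prop :=
  O <> A /\ O <> B /\ collinear O A B /\ ~ Bet A O B.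

End Notions.

Record plane_axioms (G : geometry) : Prop := PlaneAxioms {
  point_exists : exists A : Point G, True;
  distinct_point_exists : forall A : Point G, exists B : Point G, B <> A;
  line_has_point : forall x : Line G, exists A : Point G, incident A x;
  line_has_distinct_point : forall (x : Line G) (A : Point G),
    incident A x -> exists B : Point G, incident B x /\ B <> A;
  point_off_line : forall x : Line G, exists A : Point G, ~ incident A x;
  line_through : forall A B : Point G,
    A <> B -> exists x : Line G, incident A x /\ incident B x;
  line_unique : forall (A B : Point G) (x y : Line G),
    A <> B -> incident A x -> incident B x -> x <> y ->
    ~ incident A y \/ ~ incident B y;

  Bet_neq : forall A B C : Point G, Bet A B C -> A <> C;
  Bet_collinear : forall A B C : Point G, Bet A B C -> collinear A B C;
  Bet_sym : forall A B C : Point G, Bet A B C -> Bet C B A;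
  (* With [A = B] this also excludes [Bet A A C]. *)
  Bet_asym : forall A B C : Point G, Bet A B C -> ~ Bet B A C;

  dist_null : forall A B C : Point G, dist A B = dist C C <-> A = B;
  dist_sym : forall A B : Point G, dist A B = dist B A;

  line_circle : forall O A B : Point G,
    A <> O -> exists C : Point G, (Bet A O C \/ O = C) /\ dist O B = dist O C;

  pasch : forall (A B C : Point G) (x : Line G),
    opposite_sides A B x -> ~ incident C x ->
    opposite_sides A C x \/ opposite_sides C B x
}.

(* Main.v *)
(** For transitivity, suppose that O lies between A and C, and draw a line y
    through O and a point off the common line x of the four points.  Then y
    meets x only in O and separates A from C, so by Pasch it separates A from B
    or B from C; the separating point lies on x, hence is O, contrary to one of
    the hypotheses. *)
From Stdlib Require Import Classical.
Require Import Defs.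

(** The line witnessing collinearity shares the distinct points [A] and [B] with [x], so it cannot
    differ from [x]. *)
Lemma incident_of_collinear {G : geometry} (HG : plane_axioms G)
    {A B C : Point G} {x : Line G} :
  A <> B -> incident A x -> incident B x -> collinear A B C -> incident C x.
Proof.
intros nAB Ax Bx [y [Ay [By Cy]]].
apply NNPP; intros nCx.
assert (nxy : x <> y) by congruence.
destruct (line_unique HG nAB Ax Bx nxy); tauto.
Qed.

Lemma intersection_unique {G : geometry} (HG : plane_axioms G)
    {A B : Point G} {x y : Line G} :
  x <> y -> incident A x -> incident A y -> incident B x -> incident B y ->
  A = B.
Proof.
intros nxy Ax Ay Bx By.
apply NNPP; intros nAB.
destruct (line_unique HG nAB Ax Bx nxy); tauto.
Qed.

(** The point of [y] between [A] and [B] is collinear with them, hence on [x]; but [x] and [y] meet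
    only in [O]. *)
Lemma opposite_sides_Bet {G : geometry} (HG : plane_axioms G)
    {O A B : Point G} {x y : Line G} :
  x <> y -> incident O x -> incident O y -> incident A x -> incident B x ->
  opposite_sides A B y -> Bet A O B.
Proof.
intros nxy Ox Oy Ax Bx [_ [_ [Q [Qy AQB]]]].
assert (Qx : incident Q x).
{ apply (incident_of_collinear HG (Bet_neq HG AQB) Ax Bx).
  destruct (Bet_collinear HG AQB) as [z [Az [Qz Bz]]].
  exists z; tauto. }
now rewrite (intersection_unique HG nxy Ox Oy Qx Qy).
Qed.

(** A one-dimensional form of Pasch, obtained by cutting [x] transversally at [O]. *)
Lemma Bet_separation {G : geometry} (HG : plane_axioms G)
    {O A B C : Point G} {x : Line G} :
  incident O x -> incident A x -> incident B x -> incident C x ->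
  O <> A -> O <> B -> O <> C -> Bet A O C -> Bet A O B \/ Bet B O C.
Proof.
intros Ox Ax Bx Cx nOA nOB nOC AOC.
destruct (point_off_line HG x) as [P nPx].
assert (nOP : O <> P) by congruence.
destruct (line_through HG nOP) as [y [Oy Py]].
(* [P] lies on [y] but not on [x]. *)
assert (nxy : x <> y) by congruence.
assert (off_y : forall D, incident D x -> O <> D -> ~ incident D y).
{ intros D Dx nOD Dy.
  exact (nOD (intersection_unique HG nxy Ox Oy Dx Dy)). }
assert (AyC : opposite_sides A C y).
{ split; [|split]; auto.
  exists O; auto. }
destruct (pasch HG AyC (off_y B Bx nOB)) as [AyB | ByC].
- left; exact (opposite_sides_Bet HG nxy Ox Oy Ax Bx AyB).
- right; exact (opposite_sides_Bet HG nxy Ox Oy Bx Cx ByC).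
Qed.

Theorem theorem6 (G : geometry) (HG : plane_axioms G) (O A B C : Point G) :
  (O <> A -> same_half_line O A A) /\
  (same_half_line O A B -> same_half_line O B A) /\
  (same_half_line O A B -> same_half_line O B C -> same_half_line O A C).
Proof.
split; [|split].
- intros nOA.
  split; [|split; [|split]]; auto.
  + destruct (line_through HG nOA) as [x [Ox Ax]].
    exists x; auto.
  + intros AOA; exact (Bet_neq HG AOA eq_refl).
- intros [nOA [nOB [[x [Ox [Ax Bx]]] nAOB]]].
  split; [|split; [|split]]; auto.
  + exists x; auto.
  + intros BOA; exact (nAOB (Bet_sym HG BOA)).
- intros [nOA [nOB [[x [Ox [Ax Bx]]] nAOB]]] [_ [nOC [OBC nBOC]]].
  (* The two hypotheses provide a line each; both contain the distinct points [O] and [B], so all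
     four points lie on [x]. *)
  pose proof (incident_of_collinear HG nOB Ox Bx OBC) as Cx.
  split; [|split; [|split]]; auto.
  + exists x; auto.
  + intros AOC.
    destruct (Bet_separation HG Ox Ax Bx Cx nOA nOB nOC AOC); auto.
Qed.
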